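(* Let $0<s<u<1$ and put $a=(1+u)^2$, $b=(1+s)^2$, $c=(1-s)^2$, $d=(1-u)^2$. Let $$P(t)=(a-t)(t-b)(t-c)(t-d)=(a-t)(b-t)(c-t)(t-d).$$ Then for any real $\beta>-1$, $$\int_b^a\frac{P(t)^\beta}{t^\beta\sqrt t}\,dt=\int_d^c\frac{P(t)^\beta}{t^\beta\sqrt t}\,dt .$$ *)

(* Defs.v *)
From HB Require Import structures.
From mathcomp Require Import all_boot all_order all_algebra.
From mathcomp Require Import ring.
From mathcomp Require Import all_classical all_reals all_analysis.

Set Implicit Arguments.
Unset Strict Implicit.
Unset Printing Implicit Defensive.

Import Order.TTheory GRing.Theory Num.Theory.
Import numFieldNormedType.Exports.

Local Open Scope ring_scope.

Definition quartic (R : realType) (a b c d t : R) : R :=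
  (a - t) * (t - b) * (t - c) * (t - d).

(* With d < c < b < a, the defining form shows positivity on ]b, a[ and this
   one on ]d, c[. *)
Lemma quarticE (R : realType) (a b c d t : R) :
  quartic a b c d t = (a - t) * (b - t) * (c - t) * (t - d).
Proof. by rewrite /quartic; ring. Qed.

(* `^ is the real power powR; on the open intervals of integration both bases
   are positive, and the endpoints (where 0 `^ beta is a convention) form a
   null set. *)
Definition integrand (R : realType) (a b c d beta t : R) : R :=
  (quartic a b c d t) `^ beta / (t `^ beta * Num.sqrt t).

(* Main.v *)
(* Substituting t = x^2, the integrals become integrals of 2 Q(x)^beta dx over
   ]1 + s, 1 + u[ and ]1 - u, 1 - s[, where Q(x) = P(x^2) / x^2. The point is
   that Q = E^2 - g^2 with g(x) = x^3 - (2 + s^2 + u^2) x + k / x,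
   k = (1 - s^2)(1 - u^2) and E = 2 (u^2 - s^2); moreover g increases from -E
   to E on the first interval and decreases from E to -E on the second. If g
   takes the values r and -r at X, X' in the first interval and at Y, Y' in the
   second, then X, Y, -X', -Y' are the roots of
   z^4 - (2 + s^2 + u^2) z^2 - r z + k, which has no cubic term; hence
   X - X' = Y' - Y. So the sets {Q > w} have the same length on the two
   intervals: Q is equidistributed on them and the integrals agree. *)

Require Import Defs.
From HB Require Import structures.
From mathcomp Require Import all_boot all_order all_algebra.
From mathcomp Require Import ring lra.
From mathcomp Require Import all_classical all_reals all_analysis.
From mathcomp Require Import measurable_realfun.

Set Implicit Arguments.
Unset Strict Implicit.
Unset Printing Implicit Defensive.

Import Order.TTheory GRing.Theory Num.Theory.
Import numFieldNormedType.Exports.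

Local Open Scope classical_set_scope.
Local Open Scope ring_scope.

(** * Root sum of a quartic without cubic term *)

(** Newton's divided differences of [f] vanish at distinct roots: [d2] is the first and [d3] the
    second. The third one is exactly [z1 + z2 + z3 + z4], because the cubic coefficient is zero. *)
Lemma depressed_quartic_sum_roots (F : idomainType) (p q k z1 z2 z3 z4 : F) :
  let f z := z ^+ 4 + p * z ^+ 2 + q * z + k in
  uniq [:: z1; z2; z3; z4] -> f z1 = 0 -> f z2 = 0 -> f z3 = 0 -> f z4 = 0 ->
  z1 + z2 + z3 + z4 = 0.
Proof.
move=> f; rewrite /= !inE !negb_or -!andbA andbT.
case/and5P=> n12 n13 n14 n23 /andP[n24 n34] f1 f2 f3 f4.
pose d2 x y := (x + y) * (x ^+ 2 + y ^+ 2) + p * (x + y) + q.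
pose d3 x y z := x ^+ 2 + y ^+ 2 + z ^+ 2 + x * y + x * z + y * z + p.
have cancel (x y t : F) : x != y -> (x - y) * t = 0 -> t = 0.
  by move=> xy /eqP; rewrite mulf_eq0 subr_eq0 (negPf xy) => /eqP.
have e2 x y : x != y -> f x = 0 -> f y = 0 -> d2 x y = 0.
  move=> xy fx fy; apply: (cancel _ _ _ xy).
  by transitivity (f x - f y); [rewrite /f /d2; ring | rewrite fx fy subrr].
have e3 x y z : x != y -> x != z -> y != z ->
    f x = 0 -> f y = 0 -> f z = 0 -> d3 x y z = 0.
  move=> xy xz yz fx fy fz; apply: (cancel _ _ _ yz).
  transitivity (d2 x y - d2 x z); first by rewrite /d2 /d3; ring.
  by rewrite !e2 ?subrr.
apply: (cancel _ _ _ n34); transitivity (d3 z1 z2 z3 - d3 z1 z2 z4).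
  by rewrite /d3; ring.
by rewrite !e3 ?subrr.
Qed.

(** * The function g, its end values and its monotonicity *)

Section level_function.
Variables (R : realType).
Implicit Types s u x y r : R.

Definition gfun s u x : R :=
  x ^+ 3 - (2 + s ^+ 2 + u ^+ 2) * x + (1 - s ^+ 2) * (1 - u ^+ 2) / x.

Definition gmax s u : R := 2 * (u ^+ 2 - s ^+ 2).

Definition qfun s u x : R := gmax s u ^+ 2 - gfun s u x ^+ 2.

(** With E = [gmax s u], x (g - E) = (x - 1 - u) (x - 1 + u) (x + 1 + s) (x + 1 - s), and x (g + E)
    is its image under exchanging [s] and [u]. Multiplying the two pairs up the linear factors into
    differences of squares. *)
Lemma quartic_sqr s u x : x != 0 ->
  quartic ((1 + u) ^+ 2) ((1 + s) ^+ 2) ((1 - s) ^+ 2) ((1 - u) ^+ 2) (x ^+ 2)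
  = qfun s u x * x ^+ 2.
Proof. by move=> x0; rewrite /quartic /qfun /gmax /gfun; field. Qed.

Lemma gfun_1Du s u : 1 + u != 0 -> gfun s u (1 + u) = gmax s u.
Proof. by move=> u0; rewrite /gfun /gmax; field. Qed.

Lemma gfun_1Ds s u : 1 + s != 0 -> gfun s u (1 + s) = - gmax s u.
Proof. by move=> s0; rewrite /gfun /gmax; field. Qed.

Lemma gfun_1Bu s u : 1 - u != 0 -> gfun s u (1 - u) = gmax s u.
Proof. by move=> u0; rewrite /gfun /gmax; field. Qed.

Lemma gfun_1Bs s u : 1 - s != 0 -> gfun s u (1 - s) = - gmax s u.
Proof. by move=> s0; rewrite /gfun /gmax; field. Qed.

(** Factoring out [y - x] reduces monotonicity to the sign of the cofactor, without derivatives. *)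
Lemma gfunB s u x y : x != 0 -> y != 0 ->
  gfun s u y - gfun s u x = (y - x) *
    (x ^+ 2 + x * y + y ^+ 2 - (2 + s ^+ 2 + u ^+ 2)
     - (1 - s ^+ 2) * (1 - u ^+ 2) / (x * y)).
Proof. by move=> x0 y0; rewrite /gfun; field; rewrite x0 y0. Qed.

(** The three quadratic terms of the cofactor are each at least (1 + s)^2, and the quotient stays
    below 1 - u^2 since 1 - s^2 < (1 + s)^2. The cofactor thus exceeds 6 s + 2 s^2. *)
Lemma gfun_increasing s u x y : 0 < s -> s < u -> u < 1 ->
  1 + s <= x -> x < y -> gfun s u x < gfun s u y.
Proof.
move=> s0 su u1 sx xy; rewrite -subr_gt0 gfunB; try by apply/eqP; lra.
apply: mulr_gt0; first lra.
have s1 : 0 < 1 + s by lra.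
have xy0 : (1 + s) ^+ 2 <= x * y by rewrite expr2 ler_pM; lra.
have x2 : (1 + s) ^+ 2 <= x ^+ 2 by rewrite !expr2 ler_pM; lra.
have y2 : (1 + s) ^+ 2 <= y ^+ 2 by rewrite !expr2 ler_pM; lra.
have k0 : 0 < (1 - s ^+ 2) * (1 - u ^+ 2) by apply: mulr_gt0; nra.
have : (1 - s ^+ 2) * (1 - u ^+ 2) / (x * y) < 1 - u ^+ 2.
  rewrite ltr_pdivrMr; last by apply: lt_le_trans xy0; rewrite exprn_gt0.
  rewrite mulrC ltr_pM2l; nra.
nra.
Qed.

(** Here the quadratic terms are at most (1 - s)^2 each and the quotient exceeds 1 - u^2 since (1 -
    s)^2 < 1 - s^2. The cofactor thus lies below 2 s^2 - 6 s < 0. *)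
Lemma gfun_decreasing s u x y : 0 < s -> s < u -> u < 1 ->
  0 < x -> x < y -> y <= 1 - s -> gfun s u y < gfun s u x.
Proof.
move=> s0 su u1 x0 xy ys; rewrite -subr_lt0 gfunB; try by apply/eqP; lra.
rewrite pmulr_rlt0; last lra.
have y0 : 0 < y by lra.
have xy0 : x * y <= (1 - s) ^+ 2 by rewrite expr2 ler_pM; lra.
have x2 : x ^+ 2 <= (1 - s) ^+ 2 by rewrite !expr2 ler_pM; lra.
have y2 : y ^+ 2 <= (1 - s) ^+ 2 by rewrite !expr2 ler_pM; lra.
have : 1 - u ^+ 2 < (1 - s ^+ 2) * (1 - u ^+ 2) / (x * y).
  rewrite ltr_pdivlMr; last exact: mulr_gt0.
  rewrite mulrC ltr_pM2r; nra.
nra.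
Qed.

Lemma gfun_continuous s u x : x != 0 -> {for x, continuous (gfun s u)}.
Proof.
move=> x0; apply: cvgD; last first.
  by apply: cvgM; [exact: cvg_cst | exact: cvgV].
apply: cvgB; first by apply: exprn_continuous.
by apply: cvgM; [exact: cvg_cst | exact: cvg_id].
Qed.

Lemma qfun_continuous s u x : x != 0 -> {for x, continuous (qfun s u)}.
Proof.
move=> x0; apply: cvgB; first exact: cvg_cst.
apply: (@continuous_comp R R R (gfun s u) (fun y => y ^+ 2)).
  exact: gfun_continuous.
exact: exprn_continuous.
Qed.

(* If gfun takes the values r and -r at (xp, xm) and at (yp, ym), then xp, yp,
   -xm, -ym are the roots of z^4 - (2 + s^2 + u^2) z^2 - r z + k. *)
Lemma gfun_levels_length s u r xp xm yp ym :
  0 < yp -> yp < ym -> ym < xm -> xm < xp ->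
  gfun s u xp = r -> gfun s u xm = - r -> gfun s u yp = r ->
  gfun s u ym = - r ->
  xp - xm = ym - yp.
Proof.
move=> yp0 ypm ymx xmp gxp gxm gyp gym.
pose k := (1 - s ^+ 2) * (1 - u ^+ 2).
pose f z := z ^+ 4 + - (2 + s ^+ 2 + u ^+ 2) * z ^+ 2 + - r * z + k.
have root z t : z != 0 -> gfun s u z = t ->
    z ^+ 4 + - (2 + s ^+ 2 + u ^+ 2) * z ^+ 2 + - t * z + k = 0.
  by move=> z0 <-; rewrite /gfun /k; field.
have fp z : 0 < z -> gfun s u z = r -> f z = 0.
  by move=> /lt0r_neq0; exact: root.
have fm z : 0 < z -> gfun s u z = - r -> f (- z) = 0.
  move=> /lt0r_neq0 z0 /(root _ _ z0) e; rewrite -[RHS]e /f; ring.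
have := @depressed_quartic_sum_roots _ (- (2 + s ^+ 2 + u ^+ 2)) (- r) k
  xp yp (- xm) (- ym) _ (fp _ _ gxp) (fp _ _ gyp) (fm _ _ gxm) (fm _ _ gym).
have u4 : uniq [:: xp; yp; - xm; - ym].
  by rewrite /= !inE !negb_or !andbT -!andbA; apply/and5P; split=> //; last (apply/andP; split); apply/eqP; lra.
move=> /(_ u4); lra.
Qed.

End level_function.

(** * Equidistributed functions have equal integrals *)

Section equimeasurable.
Context {d} {T : measurableType d} {R : realType}.
Variable mu : {measure set T -> \bar R}.
Local Open Scope ereal_scope.

(** The complement of [D] is null for the restricted measure, and the two measures agree on subsets
    of [D]. *)
Lemma ge0_integral_mrestr (D : set T) (mD : measurable D) (f : T -> \bar R) :
  measurable_fun [set: T] f -> (forall x, 0 <= f x) ->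
  \int[mrestr mu mD]_x f x = \int[mu]_(x in D) f x.
Proof.
move=> mf f0.
have mCD : measurable (~` D) by exact: measurableC.
rewrite (@ge0_negligible_integral _ _ _ (mrestr mu mD) setT (~` D))//=; last first.
  by rewrite /mrestr setICl measure0.
rewrite setTD setCK; apply: eq_measure_integral => A mA AD.
by rewrite /= /mrestr setIidl.
Qed.

(** Each side is the integral of [h] against the image under [q1] or [q2] of the restricted measure.
    The two image measures agree on the rays []w, +oo[], which are stable under intersection and
    generate the Borel sets, so they coincide. *)
Lemma equimeasurable_ge0_integral (D1 D2 : set T) (q1 q2 : T -> R)
    (h : R -> \bar R) :
  measurable D1 -> measurable D2 -> mu D1 < +oo ->
  measurable_fun D1 q1 -> measurable_fun D2 q2 ->
  measurable_fun [set: R] h -> (forall y, 0 <= h y) ->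
  (forall w, mu (D1 `&` q1 @^-1` `]w, +oo[) = mu (D2 `&` q2 @^-1` `]w, +oo[)) ->
  \int[mu]_(x in D1) h (q1 x) = \int[mu]_(x in D2) h (q2 x).
Proof.
move=> mD1 mD2 D1oo mq1 mq2 mh h0 q12.
(* [q \_ D] extends [q] by 0 to a function measurable on the whole space; the restricted measure
   does not see the added values. *)
have push (D : set T) (mD : measurable D) (q : T -> R) :
    measurable_fun D q -> measurable_fun setT (q \_ D) /\
    \int[mu]_(x in D) h (q x) =
    \int[pushforward (mrestr mu mD) (q \_ D)]_y h y.
  move=> /(measurable_restrictT _ mD) mq; split => //.
  rewrite [RHS]ge0_integral_pushforward//= preimage_setT.
  rewrite ge0_integral_mrestr//=; last exact: measurableT_comp.
  by apply: eq_integral => x xD; rewrite /= patchE xD.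
have [mp1 ->] := push _ mD1 _ mq1; have [mp2 ->] := push _ mD2 _ mq2.
apply: eq_measure_integral => // A mA _.
apply: (@measure_unique _ R _ (@RGenOInfty.G R) (fun n => `](- n%:R)%R, +oo[%classic)) => //.
- exact: RGenOInfty.measurableE.
- move=> _ _ [x ->] [y ->]; exists (Num.max x y).
  by apply/seteqP; split => z /=; rewrite !in_itv/= !andbT gt_max => /andP.
- by move=> i; exists (- i%:R)%R.
- apply/seteqP; split => // x _; exists (Num.bound `|x|) => //=.
  rewrite in_itv/= andbT ltrNl (le_lt_trans (ler_norm (- x)%R))// normrN.
  exact: archi_boundP.
- move=> _ [w ->]; rewrite /pushforward /= /mrestr /=.
  have pre (D : set T) (q : T -> R) : (q \_ D) @^-1` `]w, +oo[ `&` D =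
      D `&` q @^-1` `]w, +oo[.
    apply/seteqP; split => x /= => [[+ Dx]|[Dx]]; by rewrite patchE mem_set.
  have := q12 w; rewrite -!pre; exact.
- move=> k; rewrite /pushforward /= /mrestr; apply: le_lt_trans D1oo.
  apply: le_measure; rewrite ?inE//; apply: measurableI => //.
  rewrite -[X in measurable X]setTI; exact: mp1.
Qed.

End equimeasurable.

(** * Improper integrals over open intervals, by compact exhaustion *)

Section open_interval_integral.
Context {R : realType}.
Notation mu := (@lebesgue_measure R).
Implicit Types (a b : R) (u v : R^nat).
Local Open Scope ereal_scope.

(** The compact intervals [[u n, v n]] increase to []a, b[]. Only order conditions are used, so that
    a continuous increasing map carries an exhaustion to an exhaustion. *)
Definition itvoo_exhausts a b u v :=
  [/\ nonincreasing_seq u, nondecreasing_seq v,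
      (forall n, (a < u n)%R /\ (v n < b)%R), (forall n, (u n < v n)%R) &
      forall x, (a < x < b)%R -> exists n, (u n <= x <= v n)%R].

Lemma itvoo_exhaustion a b : (a < b)%R -> exists u v, itvoo_exhausts a b u v.
Proof.
(* Starting at a third of the length keeps [e n] below half of it, so that [a + e n < b - e n]
   already for [n = 0]. *)
move=> ab; pose e n : R := ((b - a) / n.+3%:R)%R.
have ba : (0 < b - a)%R by rewrite subr_gt0.
have e0 n : (0 < e n)%R by rewrite divr_gt0.
have eba n : (e n + e n < b - a)%R.
  rewrite /e; set k := n.+3%:R^-1%R.
  have : (k < 2^-1)%R by rewrite ltf_pV2 ?posrE// ltr_nat.
  by nra.
have ne : nonincreasing_seq e.
  move=> m n mn; rewrite /e ler_pM2l// lef_pV2 ?posrE// ler_nat.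
  by rewrite !ltnS.
have ex t : (0 < t)%R -> exists N, (e N <= t)%R.
  move=> t0; exists (Num.bound ((b - a) / t)).
  rewrite /e ler_pdivrMr// mulrC -ler_pdivrMr//.
  apply: ltW; apply: (lt_trans (archi_boundP _)); first by rewrite divr_ge0// ltW.
  by rewrite ltr_nat !ltnS leqW// leqW.
exists (fun n => a + e n)%R, (fun n => b - e n)%R; split.
- by move=> m n mn; rewrite lerD2l; exact: ne.
- by move=> m n mn; rewrite lerD2l lerN2; exact: ne.
- by move=> n; rewrite ltrDl gtrBl.
- by move=> n; have := eba n; lra.
- move=> x /andP[ax xb].
  have [m em] : exists m, (e m <= x - a)%R by apply: ex; rewrite subr_gt0.
  have [n en] : exists n, (e n <= b - x)%R by apply: ex; rewrite subr_gt0.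
  exists (maxn m n).
  have := ne _ _ (leq_maxl m n); have := ne _ _ (leq_maxr m n); lra.
Qed.

Lemma ge0_cvg_integral_itvoo a b u v (f : R -> \bar R) :
  itvoo_exhausts a b u v ->
  measurable_fun `]a, b[ f -> (forall x, x \in `]a, b[ -> 0 <= f x) ->
  \int[mu]_(x in `[u n, v n]) f x @[n --> \oo] --> \int[mu]_(x in `]a, b[) f x.
Proof.
move=> [nu nv auvb _ ex] mf f0.
have sub n : `[u n, v n]%classic `<=` `]a, b[%classic.
  move=> x /=; rewrite !in_itv/= => /andP[ux xv].
  by have [au vb] := auvb n; rewrite (lt_le_trans au ux) (le_lt_trans xv vb).
have -> : `]a, b[%classic = \bigcup_n `[u n, v n]%classic.
  apply/seteqP; split => [x|x [n _]]; last exact: sub.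
  by rewrite /= in_itv/= => /ex[n uxv]; exists n => //=; rewrite in_itv.
apply: ge0_nondecreasing_set_cvg_integral => //.
- move=> m n mn; apply/subsetPset => x /=; rewrite !in_itv/= => /andP[ux xv].
  by rewrite (le_trans (nu _ _ mn) ux) (le_trans xv (nv _ _ mn)).
- by move=> n; apply: measurable_funS mf => //; exact: sub.
- by move=> n x /sub; exact: f0.
Qed.

Lemma continuous_in_itvoo_measurable a b (f : R -> R) :
  {in `]a, b[, continuous f} -> measurable_fun `]a, b[ f.
Proof.
move=> cf; apply: open_continuous_measurable_fun => //.
exact/in_continuous_mksetP.
Qed.

Lemma continuous_in_itvoo_within a b c d (f : R -> R) :
  {in `]a, b[, continuous f} -> (a < c)%R -> (d < b)%R ->
  {within `[c, d], continuous f}.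
Proof.
move=> cf ac db; apply: continuous_in_subspaceT => x; rewrite inE/= in_itv/=.
by move=> /andP[cx xd]; apply: cf; rewrite in_itv/=; lra.
Qed.

Lemma derivable_in_itvoo_LRcontinuous a b c d (F : R -> R) :
  {in `]a, b[, forall x : R, derivable F x 1%R} -> (a < c)%R -> (c < d)%R ->
  (d < b)%R -> derivable_oo_LRcontinuous F c d.
Proof.
move=> dF ac cd db.
have cF x : (a < x < b)%R -> {for x, continuous F}.
  move=> xab; apply/differentiable_continuous; rewrite -derivable1_diffP.
  by apply: dF; rewrite in_itv.
split.
- by move=> x; rewrite in_itv/= => xcd; apply: dF; rewrite in_itv/=; lra.
- by apply: cvg_at_right_filter; apply: cF; lra.
- by apply: cvg_at_left_filter; apply: cF; lra.
Qed.

(** On each compact piece the integral is a difference of two values of [F], hence at most [M + M];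
    monotone convergence keeps the bound, even if [f] blows up at an end. *)
Lemma ge0_integral_itvoo_lty a b (f F : R -> R) (M : R) : (a < b)%R ->
  {in `]a, b[, continuous f} -> {in `]a, b[, forall x, 0 <= f x}%R ->
  {in `]a, b[, forall x : R, is_derive x 1%R F (f x)} ->
  {in `]a, b[, forall x, `|F x| <= M}%R ->
  \int[mu]_(x in `]a, b[) (f x)%:E < +oo.
Proof.
move=> ab cf f0 dF FM; have [u [v uv]] := itvoo_exhaustion ab.
have mf : measurable_fun `]a, b[ (EFin \o f).
  by apply/measurable_EFinP; exact: continuous_in_itvoo_measurable.
apply: (@le_lt_trans _ _ (M + M)%:E); last exact: ltry.
apply: (cvge_to_le (ge0_cvg_integral_itvoo uv mf f0)); apply: nearW => n.
have [_ _ /(_ n)[au vb] /(_ n) unvn _] := uv.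
have inab x : (u n <= x <= v n)%R -> x \in `]a, b[ by rewrite in_itv/=; lra.
rewrite (@continuous_FTC2 _ f F) => //.
- rewrite -EFinB lee_fin (le_trans (ler_norm _))// (le_trans (ler_normB _ _))//.
  by apply: lerD; apply: FM; apply: inab; lra.
- exact: continuous_in_itvoo_within cf _ _.
- apply: derivable_in_itvoo_LRcontinuous au unvn vb => x xab.
  by have [] := dF x xab.
- move=> x; rewrite in_itv/= => xuv; rewrite derive1E.
  by have [] := dF x _; first by apply: inab; lra.
Qed.

(** Nonnegativity stands in for regularity of [G] at the ends: the substitution is done on each
    [[u n, v n]], and monotone convergence is applied on both sides. *)
Lemma increasing_ge0_integration_by_substitution_oo (F G : R -> R) a b :
  (a < b)%R ->
  {in `[a, b] &, {homo F : x y / (x < y)%R}} ->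
  {within `[a, b], continuous F} ->
  {in `]a, b[, forall x : R, derivable F x 1%R} ->
  {in `]a, b[, continuous F^`()%classic} ->
  {in `]F a, F b[, continuous G} -> {in `]F a, F b[, forall x, 0 <= G x}%R ->
  \int[mu]_(x in `]F a, F b[) (G x)%:E =
  \int[mu]_(x in `]a, b[) ((G (F x) * F^`()%classic x)%R)%:E.
Proof.
move=> ab incF cF dF cF' cG G0; have [u [v uv]] := itvoo_exhaustion ab.
have inab x : (a < x < b)%R -> x \in `[a, b] by rewrite in_itv/=; lra.
have ain : a \in `[a, b] by rewrite in_itv/= lexx ltW.
have bin : b \in `[a, b] by rewrite in_itv/= lexx ltW.
have Fab x : (a < x < b)%R -> (F a < F x < F b)%R.
  by move=> /[dup] xab /andP[ax xb]; apply/andP; split; apply: incF => //; exact: inab.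
have ndF x y : (a < x < b)%R -> (a < y < b)%R -> (x <= y)%R -> (F x <= F y)%R.
  move=> xab yab; rewrite le_eqVlt => /predU1P[->//|xy].
  by apply/ltW/incF; rewrite ?inab.
have Fuv : itvoo_exhausts (F a) (F b) (F \o u) (F \o v).
  have [nu nv auvb luv ex] := uv.
  have uin n : (a < u n < b)%R by have := auvb n; have := luv n; lra.
  have vin n : (a < v n < b)%R by have := auvb n; have := luv n; lra.
  split => /=.
  - by move=> m n mn; apply: ndF => //; exact: nu.
  - by move=> m n mn; apply: ndF => //; exact: nv.
  - by move=> n; have /andP[] := Fab _ (uin n); have /andP[] := Fab _ (vin n).
  - by move=> n; apply: incF; rewrite ?inab.
  move=> y /andP[ay yb].
  (* The images exhaust []F a, F b[]: a preimage [c] of [y] differs from both ends, as [y] differs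
     from [F a] and [F b], so some [[u n, v n]] contains it. *)
  have [|c] := @IVT _ F a b y (ltW ab) cF.
    by rewrite minElt maxElt (lt_trans ay yb) !ltW.
  rewrite in_itv/= => /andP[]; rewrite le_eqVlt => /predU1P[<-|ac].
    by move=> _ Fy; move: ay; rewrite Fy ltxx.
  rewrite le_eqVlt => /predU1P[->|cb] Fc.
    by move: yb; rewrite Fc ltxx.
  have cab : (a < c < b)%R by rewrite ac cb.
  have [n /andP[uc cv]] := ex c cab.
  exists n; rewrite -Fc; apply/andP; split; exact: ndF.
have mG : measurable_fun `]F a, F b[ (EFin \o G).
  by apply/measurable_EFinP; exact: continuous_in_itvoo_measurable.
have cFx x : x \in `]a, b[ -> {for x, continuous F}.
  by move=> /dF xab; apply/differentiable_continuous; rewrite -derivable1_diffP.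
have cGF : {in `]a, b[, continuous (fun x => G (F x) * F^`()%classic x)%R}.
  move=> x xab; apply: cvgM; last exact: cF'.
  apply: continuous_comp; first exact: cFx.
  by apply: cG; rewrite in_itv/= Fab//; rewrite in_itv/= in xab.
have mGF : measurable_fun `]a, b[ (EFin \o (fun x => G (F x) * F^`()%classic x)%R).
  by apply/measurable_EFinP; exact: continuous_in_itvoo_measurable.
have GF0 x : x \in `]a, b[ -> 0 <= (G (F x) * F^`()%classic x)%:E.
  move=> xab; rewrite lee_fin mulr_ge0//.
    by apply: G0; rewrite in_itv/= Fab//; rewrite in_itv/= in xab.
  apply: (@incr_derive1_ge0_itv _ F true false a b _ _ incF xab) => y.
  by rewrite inE; exact: dF.
rewrite -(cvg_lim _ (ge0_cvg_integral_itvoo Fuv mG G0))//.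
rewrite -(cvg_lim _ (ge0_cvg_integral_itvoo uv mGF GF0))//.
apply/congr_lim/funext => n /=.
have [_ _ /(_ n)[au vb] /(_ n) unvn _] := uv.
have [_ _ /(_ n)[/= Fau Fvb] _ _] := Fuv.
rewrite (@integration_by_substitution_increasing _ F G (u n) (v n)).
- by [].
- exact: ltW.
- by move=> x y; rewrite !in_itv/= => xuv yuv; apply: incF; apply: inab; lra.
- by move=> x; rewrite in_itv/= => xuv; apply: cF'; rewrite in_itv/=; lra.
- apply: (cvgP (F^`()%classic (u n))); apply: cvg_at_right_filter.
  by apply: cF'; rewrite in_itv/=; lra.
- apply: (cvgP (F^`()%classic (v n))); apply: cvg_at_left_filter.
  by apply: cF'; rewrite in_itv/=; lra.
- exact: derivable_in_itvoo_LRcontinuous dF au unvn vb.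
- exact: continuous_in_itvoo_within cG Fau Fvb.
Qed.

End open_interval_integral.

(** * Bounds for real powers and their endpoint singularities *)

Section powers.
Variable R : realType.
Implicit Types a b x y : R.

Lemma continuous_powR (beta x : R) : 0 < x ->
  {for x, continuous (@powR R ^~ beta)}.
Proof.
move=> x0; apply/differentiable_continuous; rewrite -derivable1_diffP.
by apply: derivable_powR; rewrite in_itv/= x0.
Qed.

Lemma continuous_powR_comp (f : R -> R) (beta x : R) :
  {for x, continuous f} -> 0 < f x ->
  {for x, continuous (fun y => f y `^ beta)}.
Proof.
move=> cf fx0; apply: (@continuous_comp R R R f (@powR R ^~ beta)) => //.
exact: continuous_powR.
Qed.

Lemma continuous_powR_endpoints a b (beta : R) :
  {in `]a, b[, continuous (fun x => (x - a) `^ beta + (b - x) `^ beta)}.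
Proof.
move=> x; rewrite in_itv/= => /andP[ax xb]; apply: cvgD.
  apply: (@continuous_powR_comp (fun y => y - a)); last by rewrite subr_gt0.
  by apply: cvgB; [exact: cvg_id|exact: cvg_cst].
apply: (@continuous_powR_comp (fun y => b - y)); last by rewrite subr_gt0.
by apply: cvgB; [exact: cvg_cst|exact: cvg_id].
Qed.

(** The power is monotone in its base, in a direction given by the sign of [beta]; the sum of both
    end values covers the two cases. *)
Lemma powR_le_bounds a b y (beta : R) : 0 < a -> a <= y -> y <= b ->
  y `^ beta <= a `^ beta + b `^ beta.
Proof.
move=> a0 ay yb; have y0 : 0 < y by exact: lt_le_trans ay.
have b0 : 0 < b by exact: lt_le_trans yb.
have [beta0|beta0] := leP 0 beta.
  apply: ler_wpDl; first exact: powR_ge0.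
  by apply: ge0_ler_powR => //; rewrite nnegrE; exact: ltW.
apply: ler_wpDr; first exact: powR_ge0.
rewrite -(opprK beta) (powRN y) (powRN a) lef_pV2 ?posrE ?powR_gt0//.
by apply: ge0_ler_powR => //; rewrite ?nnegrE ?oppr_ge0; exact: ltW.
Qed.

(** The larger factor lies between [(x + y) / 2] and [x + y], which bounds its power. Thus, for
    fixed [x + y], a product of two singularities is dominated by their sum. *)
Lemma powRM_le_add x y (beta : R) : 0 < x -> 0 < y ->
  (x * y) `^ beta <= (((x + y) / 2) `^ beta + (x + y) `^ beta) *
                     (x `^ beta + y `^ beta).
Proof.
wlog xy : x y / x <= y => [wlg x0 y0|x0 y0].
  have [xy|yx] := leP x y; first exact: wlg.
  by rewrite mulrC (addrC x) (addrC (x `^ _)); apply: wlg => //; exact: ltW.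
rewrite powRM ?(ltW x0) ?(ltW y0)// mulrC ler_pM ?powR_ge0//.
  by apply: powR_le_bounds; lra.
by rewrite lerDl powR_ge0.
Qed.

Lemma integral_powR_endpoints_lty a b (beta : R) : a < b -> -1 < beta ->
  (\int[@lebesgue_measure R]_(x in `]a, b[)
     ((x - a) `^ beta + (b - x) `^ beta)%:E < +oo)%E.
Proof.
move=> ab beta1; have b0 : 0 < beta + 1 by lra.
pose F x := (beta + 1)^-1 * ((x - a) `^ (beta + 1) - (b - x) `^ (beta + 1)).
apply: (@ge0_integral_itvoo_lty _ _ _ _ F
  ((beta + 1)^-1 * (b - a) `^ (beta + 1))) => //.
- exact: continuous_powR_endpoints.
- by move=> x _; rewrite addr_ge0 ?powR_ge0.
- move=> x; rewrite in_itv/= => /andP[ax xb].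
  have x0 : 0 < x - a by rewrite subr_gt0.
  have y0 : 0 < b - x by rewrite subr_gt0.
  have dL : is_derive x 1 (fun x => (x - a) `^ (beta + 1))
      ((beta + 1) * (x - a) `^ beta).
    have dg : is_derive x 1 (fun x : R => x - a) (1 - 0) by exact: is_deriveB.
    have df := @is_derive1_powR R (beta + 1) (x - a) x0.
    apply: (is_derive_eq (@is_derive1_comp _ _ (fun x => x - a) _ _ _ df dg)).
    by rewrite subr0 mulr1 addrK.
  have dR : is_derive x 1 (fun x => (b - x) `^ (beta + 1))
      (- ((beta + 1) * (b - x) `^ beta)).
    have dg : is_derive x 1 (fun x : R => b - x) (0 - 1) by exact: is_deriveB.
    have df := @is_derive1_powR R (beta + 1) (b - x) y0.
    apply: (is_derive_eq (@is_derive1_comp _ _ (fun x => b - x) _ _ _ df dg)).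
    by rewrite sub0r mulrN1 addrK.
  apply: (is_derive_eq (is_deriveZ (beta + 1)^-1 (is_deriveB dL dR))).
  rewrite opprK -mulrDr /GRing.scale/= mulrA mulVf ?mul1r//; exact: lt0r_neq0.
- move=> x; rewrite in_itv/= => /andP[ax xb].
  rewrite /F normrM gtr0_norm ?invr_gt0// ler_pM2l ?invr_gt0//.
  have le y : 0 < y -> y <= b - a -> y `^ (beta + 1) <= (b - a) `^ (beta + 1).
    move=> y0 yba; apply: ge0_ler_powR => //; rewrite ?nnegrE; lra.
  have := powR_ge0 (x - a) (beta + 1); have := powR_ge0 (b - x) (beta + 1).
  have := le (x - a); have := le (b - x).
  rewrite ler_norml; lra.
Qed.

End powers.

(** * Superlevel sets of Q on the two intervals *)

Section level_sets.
Variable R : realType.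
Implicit Types s u w r x A B : R.
Notation mu := (@lebesgue_measure R).

(** The left inequality means [g xm < g x < g xp], which strict monotonicity reflects to the
    arguments. *)
Lemma sqr_lt_increasing (g : R -> R) A B r xm xp :
  {in `[A, B] &, {homo g : x y / x < y}} -> 0 < r ->
  xm \in `[A, B] -> xp \in `[A, B] -> g xm = - r -> g xp = r ->
  {in `[A, B], forall x, (g x ^+ 2 < r ^+ 2) = (xm < x < xp)}.
Proof.
move=> incg r0 xmAB xpAB gxm gxp x xAB.
have mono := leW_mono_in (le_mono_in incg).
rewrite -(real_normK (num_real (g x))) ltr_pXn2r ?nnegrE ?(ltW r0)//.
by rewrite ltr_norml -gxm -gxp !mono.
Qed.

(** Where Q is positive, a negative level [w] acts like level 0. *)
Lemma qfun_gt s u w x : 0 < qfun s u x ->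
  (w < qfun s u x) = (gfun s u x ^+ 2 < gmax s u ^+ 2 - Num.max w 0).
Proof.
by move=> q0; rewrite [RHS]ltrBrDr -[RHS]ltrBrDl -/(qfun s u x) gt_max q0 andbT.
Qed.

Lemma gmax_gt0 s u : 0 < s -> s < u -> 0 < gmax s u.
Proof. by move=> s0 su; rewrite /gmax subr_sqr !mulr_gt0 //; lra. Qed.

Lemma gfun_increasing_in s u : 0 < s -> s < u -> u < 1 ->
  {in `[1 + s, 1 + u] &, {homo gfun s u : x y / x < y}}.
Proof.
move=> s0 su u1 x y; rewrite !in_itv/= => /andP[sx _] _; exact: gfun_increasing.
Qed.

Lemma oppgfun_increasing_in s u : 0 < s -> s < u -> u < 1 ->
  {in `[1 - u, 1 - s] &, {homo (fun x => - gfun s u x) : x y / x < y}}.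
Proof.
move=> s0 su u1 x y; rewrite !in_itv/= => /andP[ux _] /andP[_ ys] xy.
by rewrite ltrN2; apply: gfun_decreasing => //; lra.
Qed.

Lemma qfun_gt0_outer s u : 0 < s -> s < u -> u < 1 ->
  {in `]1 + s, 1 + u[, forall x, 0 < qfun s u x}.
Proof.
move=> s0 su u1 x xsu; rewrite subr_gt0.
have inc := gfun_increasing_in s0 su u1; have E0 := gmax_gt0 s0 su.
have xin : x \in `[1 + s, 1 + u] by exact: subset_itv_oo_cc.
rewrite (@sqr_lt_increasing _ (1 + s) (1 + u) _ (1 + s) (1 + u))//.
- by rewrite in_itv/=; lra.
- by rewrite in_itv/=; lra.
- by apply: gfun_1Ds; apply/eqP; lra.
- by apply: gfun_1Du; apply/eqP; lra.
Qed.

(** Q depends on g only through its square, so the increasing function [- gfun s u] may replace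
    g. *)
Lemma qfun_gt0_inner s u : 0 < s -> s < u -> u < 1 ->
  {in `]1 - u, 1 - s[, forall x, 0 < qfun s u x}.
Proof.
move=> s0 su u1 x xus.
have dec := oppgfun_increasing_in s0 su u1; have E0 := gmax_gt0 s0 su.
rewrite subr_gt0 -(sqrrN (gfun s u x)).
have xin : x \in `[1 - u, 1 - s] by exact: subset_itv_oo_cc.
rewrite (@sqr_lt_increasing (fun x => - gfun s u x) (1 - u) (1 - s) _ (1 - u) (1 - s))//.
- by rewrite in_itv/=; lra.
- by rewrite in_itv/=; lra.
- by rewrite gfun_1Bu//; apply/eqP; lra.
- by rewrite gfun_1Bs ?opprK//; apply/eqP; lra.
Qed.

(** The [Num.min] and [Num.max] form serves both the interval where g increases and the one where it
    decreases. *)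
Lemma gfun_IVT s u A B r : 0 < A -> A <= B ->
  Num.min (gfun s u A) (gfun s u B) <= r <= Num.max (gfun s u A) (gfun s u B) ->
  exists2 x, x \in `[A, B] & gfun s u x = r.
Proof.
move=> A0 AB; apply: IVT => //; apply: continuous_in_subspaceT => x.
rewrite inE/= in_itv/= => /andP[Ax _].
by apply: gfun_continuous; apply: lt0r_neq0; exact: lt_le_trans Ax.
Qed.

Lemma qfun_equimeasurable s u w : 0 < s -> s < u -> u < 1 ->
  mu (`]1 + s, 1 + u[ `&` qfun s u @^-1` `]w, +oo[) =
  mu (`]1 - u, 1 - s[ `&` qfun s u @^-1` `]w, +oo[).
Proof.
move=> s0 su u1; have E0 := gmax_gt0 s0 su.
have inc := gfun_increasing_in s0 su u1; have dec := oppgfun_increasing_in s0 su u1.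
have qE (A B : R) : {in `]A, B[, forall x, 0 < qfun s u x} ->
    `]A, B[ `&` qfun s u @^-1` `]w, +oo[ = `]A, B[ `&`
    [set x | gfun s u x ^+ 2 < gmax s u ^+ 2 - Num.max w 0].
  move=> q0; apply/seteqP; split => x /= [xAB]; have qx := q0 x xAB.
    by rewrite in_itv/= andbT qfun_gt.
  by move=> gx; split => //; rewrite in_itv/= andbT qfun_gt.
rewrite (qE _ _ (qfun_gt0_outer s0 su u1)) (qE _ _ (qfun_gt0_inner s0 su u1)).
set e := gmax s u ^+ 2 - Num.max w 0.
have eE : e <= gmax s u ^+ 2 by rewrite gerBl le_max lexx orbT.
(* Levels [w] from [gmax s u ^+ 2] upwards: both sets are empty. *)
have [e0|e0] := leP e 0.
  have empty (D : set R) : D `&` [set x | gfun s u x ^+ 2 < e] = set0.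
    apply/seteqP; split => // x [_ /= ge].
    by have := sqr_ge0 (gfun s u x); rewrite leNgt (lt_le_trans ge e0).
  by rewrite !empty.
(* Since 0 < [r] <= [gmax s u], both [r] and [- r] are attained on each closed interval, and the
   superlevel sets are the open intervals between these points. *)
pose r : R := Num.sqrt e.
have r0 : 0 < r by rewrite sqrtr_gt0.
have r2 : r ^+ 2 = e by rewrite sqr_sqrtr// ltW.
have rE : r <= gmax s u.
  by rewrite -(ler_pXn2r (n := 2)) ?nnegrE ?r2// ltW.
have gs1 : gfun s u (1 + s) = - gmax s u by apply: gfun_1Ds; apply/eqP; lra.
have gu1 : gfun s u (1 + u) = gmax s u by apply: gfun_1Du; apply/eqP; lra.
have gs2 : gfun s u (1 - s) = - gmax s u by apply: gfun_1Bs; apply/eqP; lra.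
have gu2 : gfun s u (1 - u) = gmax s u by apply: gfun_1Bu; apply/eqP; lra.
have [s1 su1 u0 us1] : [/\ 0 < 1 + s, 1 + s <= 1 + u, 0 < 1 - u & 1 - u <= 1 - s].
  by split; lra.
have [|xp xpin gxp] := @gfun_IVT s u _ _ r s1 su1.
  by rewrite ge_min le_max gs1 gu1; apply/andP; split; apply/orP; [left|right]; lra.
have [|xm xmin gxm] := @gfun_IVT s u _ _ (- r) s1 su1.
  by rewrite ge_min le_max gs1 gu1; apply/andP; split; apply/orP; [left|right]; lra.
have [|yp ypin gyp] := @gfun_IVT s u _ _ r u0 us1.
  by rewrite ge_min le_max gs2 gu2; apply/andP; split; apply/orP; [right|left]; lra.
have [|ym ymin gym] := @gfun_IVT s u _ _ (- r) u0 us1.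
  by rewrite ge_min le_max gs2 gu2; apply/andP; split; apply/orP; [right|left]; lra.
have xmp : xm < xp.
  by rewrite -(leW_mono_in (le_mono_in inc))// gxm gxp; lra.
have ypm : yp < ym.
  by rewrite -(leW_mono_in (le_mono_in dec))// gym gyp; lra.
have setE1 : `]1 + s, 1 + u[ `&` [set x | gfun s u x ^+ 2 < e] = `]xm, xp[%classic.
  have lv := sqr_lt_increasing inc r0 xmin xpin gxm gxp.
  apply/seteqP; split => x /=; rewrite -r2.
    by move=> [xsu]; rewrite lv ?in_itv//; exact: subset_itv_oo_cc.
  rewrite !in_itv/= => xx; move: xmin xpin; rewrite !in_itv/= => xmin xpin.
  by split; [lra | rewrite lv ?in_itv/=; lra].
have setE2 : `]1 - u, 1 - s[ `&` [set x | gfun s u x ^+ 2 < e] = `]yp, ym[%classic.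
  have lv x : x \in `[1 - u, 1 - s] -> (gfun s u x ^+ 2 < r ^+ 2) = (yp < x < ym).
    move=> xin; rewrite -sqrrN.
    by apply: (sqr_lt_increasing dec) => //; rewrite ?gyp ?gym ?opprK.
  apply/seteqP; split => x /=; rewrite -r2.
    by move=> [xsu]; rewrite lv ?in_itv//; exact: subset_itv_oo_cc.
  rewrite !in_itv/= => yy; move: ymin ypin; rewrite !in_itv/= => ymin ypin.
  by split; [lra | rewrite lv ?in_itv/=; lra].
rewrite setE1 setE2 !lebesgue_measure_itv/= !lte_fin xmp ypm -!EFinB.
(* The order [ym < xm] comes from [ym <= 1 - s < 1 + s <= xm]. *)
congr EFin; move: xmin ypin ymin; rewrite !in_itv/= => xmin ypin ymin.
by apply: gfun_levels_length gxp gxm gyp gym; lra.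
Qed.

End level_sets.

(** * The substitution t = x^2 and finiteness of the integrals *)

Section squares.
Variable R : realType.
Implicit Types a b c d s u x t beta : R.
Notation mu := (@lebesgue_measure R).

Lemma integrand_ge0 a b c d beta t : 0 <= integrand a b c d beta t.
Proof. by rewrite divr_ge0 ?mulr_ge0 ?powR_ge0 ?sqrtr_ge0. Qed.

Lemma quartic_continuous a b c d : continuous (quartic a b c d).
Proof.
move=> t; apply: cvgM; [apply: cvgM; [apply: cvgM|]|];
  by apply: cvgB; first [exact: cvg_id | exact: cvg_cst].
Qed.

Lemma integrand_continuous a b c d beta t : 0 < t -> 0 < quartic a b c d t ->
  {for t, continuous (integrand a b c d beta)}.
Proof.
move=> t0 q0; apply: cvgM.
  apply: (@continuous_powR_comp _ (quartic a b c d)) => //; exact: quartic_continuous.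
apply: cvgV; first by rewrite mulf_neq0 ?lt0r_neq0 ?powR_gt0 ?sqrtr_gt0.
by apply: cvgM; [exact: continuous_powR | exact: sqrt_continuous].
Qed.

Lemma integrand_sqr s u beta x : 0 < x -> 0 < qfun s u x ->
  integrand ((1 + u) ^+ 2) ((1 + s) ^+ 2) ((1 - s) ^+ 2) ((1 - u) ^+ 2) beta
    (x ^+ 2) = qfun s u x `^ beta / x.
Proof.
move=> x0 q0; rewrite /integrand quartic_sqr ?lt0r_neq0//.
rewrite powRM ?(ltW q0) ?sqr_ge0// sqrtr_sqr gtr0_norm//.
have X0 : (x ^+ 2) `^ beta != 0 by rewrite lt0r_neq0 ?powR_gt0 ?exprn_gt0.
by rewrite invfM mulrA mulfK.
Qed.

(** The Jacobian 2 x cancels the factor 1 / x left by [integrand_sqr]. Passing to open intervals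
    discards the endpoints, where the quartic may vanish. *)
Lemma integral_integrand_sqr s u beta (A B : R) : 0 < A -> A < B ->
  {in `]A, B[, forall x, 0 < qfun s u x} ->
  let f := integrand ((1 + u) ^+ 2) ((1 + s) ^+ 2) ((1 - s) ^+ 2)
             ((1 - u) ^+ 2) beta in
  measurable_fun `[A ^+ 2, B ^+ 2] f /\
  (\int[mu]_(t in `[(A ^+ 2)%R, (B ^+ 2)%R]) (f t)%:E =
   \int[mu]_(x in `]A, B[) (2 * qfun s u x `^ beta)%R%:E)%E.
Proof.
move=> A0 AB q0 f; have B0 : 0 < B by exact: lt_trans AB.
have cf : {in `]A ^+ 2, B ^+ 2[, continuous f}.
  move=> t; rewrite in_itv/= => /andP[At tB].
  have t0 : 0 < t by apply: lt_trans At; rewrite exprn_gt0.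
  have x0 : 0 < Num.sqrt t by rewrite sqrtr_gt0.
  have tE : t = Num.sqrt t ^+ 2 by rewrite sqr_sqrtr// ltW.
  apply: integrand_continuous => //; rewrite {1}tE quartic_sqr ?lt0r_neq0//.
  apply: mulr_gt0; last exact: exprn_gt0.
  have Ax : A < Num.sqrt t.
    by rewrite -(ltr_pXn2r (n := 2)) ?nnegrE ?(ltW A0) ?(ltW x0)// -tE.
  have xB : Num.sqrt t < B.
    by rewrite -(ltr_pXn2r (n := 2)) ?nnegrE ?(ltW B0) ?(ltW x0)// -tE.
  by apply: q0; rewrite in_itv/= Ax xB.
have mf := continuous_in_itvoo_measurable cf.
split; first exact: measurable_fun_itv_cc mf.
rewrite [LHS]integral_itv_bndoo; last by apply/measurable_EFinP.
pose F := @GRing.exp R ^~ 2.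
have incF : {in `[A, B] &, {homo F : x y / x < y}}.
  move=> x y; rewrite !in_itv/= => /andP[Ax _] /andP[Ay _] xy.
  by rewrite /F ltr_pXn2r// nnegrE ltW// (lt_le_trans A0).
transitivity (\int[mu]_(x in `]A, B[) (f (F x) * F^`()%classic x)%:E)%E.
  apply: (@increasing_ge0_integration_by_substitution_oo _ F f A B) => //.
  - by apply: continuous_subspaceT => x; exact: exprn_continuous.
  - move=> x _; rewrite (_ : F^`()%classic = fun y => 2%:R * y).
      by apply: cvgM; [exact: cvg_cst|exact: cvg_id].
    by apply/funext => y; rewrite exp_derive1.
  - by move=> x _; exact: integrand_ge0.
apply: eq_integral => x; rewrite inE/= => xAB; congr EFin.
have x0 : 0 < x by move: xAB; rewrite in_itv/= => /andP[/(lt_trans A0)].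
rewrite /F exp_derive1 /f integrand_sqr ?q0// expr1 /GRing.scale/=.
by field; rewrite lt0r_neq0.
Qed.

Lemma lebesgue_measure_itvoo_lty (A B : R) : (mu `]A, B[ < +oo)%E.
Proof. by rewrite lebesgue_measure_itv/=; case: ifP; rewrite -?EFinB ltry. Qed.

(** Q is (x - 1 - s) (1 + u - x) times a factor [m] bounded away from 0 and infinity, so its power
    is dominated by a multiple of the endpoint singularities [g]. *)
Lemma integral_qfun_lty s u beta : 0 < s -> s < u -> u < 1 -> -1 < beta ->
  (\int[mu]_(x in `](1 + s)%R, (1 + u)%R[) (2 * qfun s u x `^ beta)%R%:E < +oo)%E.
Proof.
move=> s0 su u1 beta1.
have q0 := qfun_gt0_outer s0 su u1.
(* The first factor is the constant of [powRM_le_add], as the two linear factors add up to [u - s];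
   the second bounds the power of [m], which lies between [s ^+ 2] and 256. *)
pose K := (((u - s) / 2) `^ beta + (u - s) `^ beta) *
          ((s ^+ 2) `^ beta + (256 : R) `^ beta).
pose g x := (x - (1 + s)) `^ beta + (1 + u - x) `^ beta.
have mp (h : R -> R) : {in `]1 + s, 1 + u[, continuous h} ->
    measurable_fun `]1 + s, 1 + u[ (fun x => (h x)%:E).
  move=> ch; apply/measurable_EFinP; exact: (continuous_in_itvoo_measurable ch).
have cq : {in `]1 + s, 1 + u[, continuous (fun x => 2 * qfun s u x `^ beta)}.
  move=> x /[dup] xsu; rewrite in_itv/= => /andP[sx _].
  apply: cvgM; first exact: cvg_cst.
  apply: (@continuous_powR_comp _ (qfun s u)); last exact: q0.
  by apply: qfun_continuous; apply/eqP; lra.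
have cg : {in `]1 + s, 1 + u[, continuous g}.
  exact: continuous_powR_endpoints.
have K0 : 0 <= K by rewrite mulr_ge0 ?addr_ge0 ?powR_ge0.
have g0 x : 0 <= g x by rewrite addr_ge0 ?powR_ge0.
apply: (@le_lt_trans _ _ (\int[mu]_(x in `](1 + s)%R, (1 + u)%R[) ((2 * K)%:E * (g x)%:E))%E); last first.
  rewrite ge0_integralZl//; last 3 first.
  - exact: mp.
  - by move=> x _; rewrite lee_fin.
  - by rewrite lee_fin mulr_ge0.
  apply: lte_mul_pinfty => //; first by rewrite lee_fin mulr_ge0.
  by apply: integral_powR_endpoints_lty => //; lra.
apply: ge0_le_integral => //.
- by move=> x _; rewrite lee_fin mulr_ge0 ?powR_ge0.
- exact: mp.
- by apply: measurable_funeM; exact: mp.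
move=> x /= xsu; rewrite -EFinM lee_fin -mulrA ler_pM2l//.
have := xsu; rewrite in_itv/= => /andP[sx xu].
pose p := x - (1 + s); pose q := 1 + u - x.
pose m := (x + (1 + s)) * (x + (1 + u)) * (x ^+ 2 - (1 - s) ^+ 2) *
          (x ^+ 2 - (1 - u) ^+ 2) / x ^+ 2.
have qE : qfun s u x = p * q * m.
  by rewrite /qfun /gfun /gmax /p /q /m; field; apply/eqP; lra.
have p0 : 0 < p by rewrite /p; lra.
have q'0 : 0 < q by rewrite /q; lra.
(* Crude bounds from 1 < [x] < 2; the lower bound 4 s comes from (1 + s)^2 - (1 - s)^2. *)
have x2 : 1 <= x ^+ 2 <= 4 by apply/andP; split; nra.
have D1 : 4 * s <= x ^+ 2 - (1 - s) ^+ 2 <= 4 by apply/andP; split; nra.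
have D2 : 4 * s <= x ^+ 2 - (1 - u) ^+ 2 <= 4 by apply/andP; split; nra.
have P12 : 1 <= (x + (1 + s)) * (x + (1 + u)) <= 16 by apply/andP; split; nra.
have D12 : (4 * s) * (4 * s) <=
    (x ^+ 2 - (1 - s) ^+ 2) * (x ^+ 2 - (1 - u) ^+ 2) <= 16 by apply/andP; split; nra.
have sm : s ^+ 2 <= m.
  rewrite ler_pdivlMr; last lra.
  rewrite -[X in _ <= X]mulrA; nra.
have m256 : m <= 256.
  rewrite ler_pdivrMr; last lra.
  apply: (@le_trans _ _ (16 * 16)); last lra.
  rewrite -[X in X <= _]mulrA; move: P12 D12 => /andP[P1 P16] /andP[DS D16].
  apply: ler_pM => //; first exact: le_trans P1.
  by apply: le_trans DS; rewrite !mulr_ge0// ltW.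
have pq0 : 0 <= p * q by rewrite ltW ?mulr_gt0.
rewrite qE (powRM _ pq0 (le_trans (sqr_ge0 s) sm)).
apply: (@le_trans _ _ ((((u - s) / 2) `^ beta + (u - s) `^ beta) * g x *
    ((s ^+ 2) `^ beta + (256 : R) `^ beta))); last by rewrite /K mulrAC.
apply: ler_pM; rewrite ?powR_ge0//.
  have := powRM_le_add beta p0 q'0.
  by rewrite (_ : p + q = u - s)// /p /q; ring.
by apply: powR_le_bounds => //; rewrite exprn_gt0.
Qed.

End squares.

(** Integrability belongs to the conclusion because the real-valued integral turns an infinite value
    into 0, so the equality alone would not exclude divergence. *)
Theorem theorem2p5 (R : realType) (s u beta : R)
    (hs : 0 < s) (hsu : s < u) (hu : u < 1) (hbeta : -1 < beta) :
  let mu := @lebesgue_measure R in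
  let a := (1 + u) ^+ 2 in
  let b := (1 + s) ^+ 2 in
  let c := (1 - s) ^+ 2 in
  let d := (1 - u) ^+ 2 in
  let f := integrand a b c d beta in
  [/\ mu.-integrable `[b, a] (EFin \o f),
      mu.-integrable `[d, c] (EFin \o f)
    & \int[mu]_(t in `[b, a]) f t = \int[mu]_(t in `[d, c]) f t].
Proof.
move=> mu a b c d f.
have qo := qfun_gt0_outer hs hsu hu; have qi := qfun_gt0_inner hs hsu hu.
have s1 : 0 < 1 + s by lra.
have u1 : 0 < 1 - u by lra.
have su1 : 1 + s < 1 + u by lra.
have us1 : 1 - u < 1 - s by lra.
have [mo Io] := integral_integrand_sqr beta s1 su1 qo.
have [mi Ii] := integral_integrand_sqr beta u1 us1 qi.
(* Equality holds first in the extended reals, by nonnegativity; it then carries finiteness from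
   [[b, a]] over to [[d, c]]. *)
have IoIi : (\int[mu]_(t in `[b, a]) (f t)%:E =
             \int[mu]_(t in `[d, c]) (f t)%:E)%E.
  have mq (A B : R) : {in `]A, B[, forall x, 0 < x} ->
      measurable_fun `]A, B[ (qfun s u).
    move=> AB; apply: continuous_in_itvoo_measurable => x /AB /lt0r_neq0.
    exact: qfun_continuous.
  rewrite Io Ii.
  apply: (@equimeasurable_ge0_integral _ _ _ mu _ _ (qfun s u) (qfun s u)
    (fun y => (2 * y `^ beta)%:E)) => //.
  - exact: lebesgue_measure_itvoo_lty.
  - by apply: mq => x; rewrite in_itv/= => /andP[/(lt_trans s1)].
  - by apply: mq => x; rewrite in_itv/= => /andP[/(lt_trans u1)].
  - by apply/measurable_EFinP; apply: measurable_funM => //; exact: measurable_powR.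
  - by move=> y; rewrite lee_fin mulr_ge0 ?powR_ge0.
  - by move=> w; exact: qfun_equimeasurable.
have abs A : (\int[mu]_(t in A) `|(EFin \o f) t| = \int[mu]_(t in A) (f t)%:E)%E.
  by apply: eq_integral => t _; rewrite gee0_abs// lee_fin integrand_ge0.
have Ilty := integral_qfun_lty hs hsu hu hbeta.
split.
- by apply/integrableP; split; [exact/measurable_EFinP | rewrite abs Io].
- by apply/integrableP; split; [exact/measurable_EFinP | rewrite abs -IoIi Io].
- by rewrite /Rintegral IoIi.
Qed.
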